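(* For all integers $\kappa, s \ge 1$ there exists $c$ such that for every coloured graph $(G,\phi)$ with $\omega(G)\le \kappa$ and $\chi(G)>c$, there is a rainbow induced subgraph of $G$ isomorphic to an $s$-vertex path.
   Context: Graphs are finite and have no loops or multiple edges. $\chi(G)$ and $\omega(G)$ denote the chromatic number and the clique number of $G$. A colouring of a graph $G$ is a map $\phi$ from $V(G)$ to the set of positive integers such that $\phi(u)\ne\phi(v)$ for all adjacent $u,v$ (it need not use the minimum number of colours). A coloured graph is a pair $(G,\phi)$ where $G$ is a graph and $\phi$ is a colouring of $G$. Given a coloured graph $(G,\phi)$, a subgraph $H$ of $G$ is rainbow if $\phi(u)\ne\phi(v)$ for all distinct $u,v\in V(H)$. *)

(* Defs.v *)
From mathcomp Require Import all_boot.

Set Implicit Arguments.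
Unset Strict Implicit.
Unset Printing Implicit Defensive.

Record graph := Graph {
  vertex :> finType;
  adj : rel vertex;
  adj_sym : symmetric adj;
  adj_irr : irreflexive adj
}.

Definition proper (G : graph) (C : eqType) (f : G -> C) : bool :=
  [forall u, forall v, adj u v ==> (f u != f v)].

Definition colouring (G : graph) (phi : G -> nat) : Prop :=
  (forall v, 0 < phi v) /\ proper phi.

Record coloured_graph := ColouredGraph {
  cgraph :> graph;
  colour : cgraph -> nat;
  colourP : colouring colour
}.

Definition clique (G : graph) (A : {set G}) : bool :=
  [forall u in A, forall v in A, (u != v) ==> adj u v].

Definition omega (G : graph) : nat := \max_(A : {set G} | clique A) #|A|.

Definition colourable (G : graph) (k : nat) : bool :=
  [exists f : {ffun G -> 'I_k}, proper f].

Lemma colourable_ex (G : graph) : exists k, colourable G k.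
Proof.
exists #|G|; apply/existsP; exists [ffun v => enum_rank v].
apply/forallP => u; apply/forallP => v; apply/implyP => uv.
rewrite !ffunE; apply/eqP => /enum_rank_inj euv.
by rewrite euv adj_irr in uv.
Qed.

Definition chi (G : graph) : nat := ex_minn (colourable_ex G).

Section Induced.
Variables (G : graph) (A : {set G}).

Definition induced_adj : rel {x : G | x \in A} :=
  fun u v => adj (val u) (val v).

Lemma induced_sym : symmetric induced_adj.
Proof. by move=> u v; apply: adj_sym. Qed.

Lemma induced_irr : irreflexive induced_adj.
Proof. by move=> u; apply: adj_irr. Qed.

Definition induced : graph := Graph induced_sym induced_irr.

End Induced.

Section Path.
Variable s : nat.

Definition path_adj : rel 'I_s := fun i j => (i.+1 == j) || (j.+1 == i).

Lemma path_sym : symmetric path_adj.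
Proof. by move=> i j; rewrite /path_adj orbC. Qed.

Lemma path_irr : irreflexive path_adj.
Proof. by move=> i; rewrite /path_adj orbb -{2}[val i]addn0 -addn1 eqn_add2l. Qed.

(* The path on s vertices (s counts vertices, not edges). *)
Definition path_graph : graph := Graph path_sym path_irr.

End Path.

Definition isomorphic (G H : graph) : Prop :=
  exists f : G -> H, bijective f /\ forall u v, adj (f u) (f v) = adj u v.

(* Whether a subgraph is rainbow depends only on its vertex set A. *)
Definition rainbow (G : coloured_graph) (A : {set G}) : Prop :=
  forall u v, u \in A -> v \in A -> u <> v -> colour u <> colour v.

(* Main.v *)
Require Import Defs.
From mathcomp Require Import all_boot.

Set Implicit Arguments.
Unset Strict Implicit.
Unset Printing Implicit Defensive.

(** Suppose that no rainbow induced path of a coloured graph has [s] vertices;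
the chromatic number is then bounded in terms of [s] and of the clique number.

The engine is [colourable_cover].  Within the union of sets [X u], each of them
[c]-colourable, suppose that every vertex of [X u] sees only few colours among
its neighbours outside [X u].  Then the union has bounded chromatic number, for
the following reason.  Send each vertex to the first set that contains it.
After a product colouring, only edges between different sets matter, and these
split into two acyclic digraphs: along an edge the index of the set increases,
and the colour either increases or decreases.  If both digraphs have only short
directed paths, then a Gallai-Roy colouring ([gallai_roy]) finishes.  A long
directed path in one of them is rainbow because colours are monotone along it,
and each of its vertices has few neighbours further on: these lie outside the
set of that vertex and have distinct colours.  Such a path contains a long
induced one ([sparse_rainbow_path]), which is impossible.

The sets come from paths.  For a list [w] of vertices, [reach A w] collects the
first vertices of the rainbow induced paths in [A] that end with the segment
[w] and are longer than it.  If [x] is reached by a path and a neighbour [y] of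
[x] has a colour not on this path, then [y] can be joined directly to the path
and its part before the attachment dropped, so [y] is reached as well.  Hence
the sets [reach A (u :: w)], for varying [u], satisfy the hypothesis on outside
neighbours ([reach_outside]).  They cover [reach A w] except for vertices
adjacent to the head of [w], whose chromatic number is bounded by induction on
the clique number, or, if [w] is empty, for isolated vertices.  So a bound for
segments of one length gives a bound for segments of length one less
([reach_colourable]).  Segments with [s] vertices reach nothing, and the empty
segment reaches all of [A]. *)

(** * Colourings of vertex sets *)

Section Colouring.
Variable G : graph.

Definition colourable_in (A : {set G}) (c : nat) : bool :=
  [exists f : {ffun G -> 'I_c},
    [forall x in A, forall y in A, adj x y ==> (f x != f y)]].

Lemma colourable_inP (A : {set G}) (c : nat) :
  reflect (exists f : {ffun G -> 'I_c},
             {in A &, forall x y, adj x y -> f x != f y})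
          (colourable_in A c).
Proof.
apply: (iffP existsP) => -[f Hf]; exists f.
  move=> x y xA yA xy.
  by move/forall_inP/(_ x xA)/forall_inP/(_ y yA)/implyP/(_ xy): Hf.
apply/forall_inP=> x xA; apply/forall_inP=> y yA; apply/implyP=> xy.
exact: Hf.
Qed.

Lemma colourable_in_finType (T : finType) (f : G -> T) (A : {set G}) :
  {in A &, forall x y, adj x y -> f x != f y} -> colourable_in A #|T|.
Proof.
move=> Hf; apply/colourable_inP; exists [ffun x => enum_rank (f x)].
by move=> x y xA yA xy; rewrite !ffunE (inj_eq enum_rank_inj); apply: Hf.
Qed.

Lemma colourable_inW (A B : {set G}) (c d : nat) :
  A \subset B -> c <= d -> colourable_in B c -> colourable_in A d.
Proof.
move=> /subsetP AB cd /colourable_inP[f Hf]; apply/colourable_inP.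
exists [ffun x => widen_ord cd (f x)] => x y xA yA xy.
by rewrite !ffunE -val_eqE /= val_eqE; apply: Hf => //; apply: AB.
Qed.

Lemma colourable_inU (A B : {set G}) (c d : nat) :
  colourable_in A c -> colourable_in B d -> colourable_in (A :|: B) (c + d).
Proof.
move=> /colourable_inP[f Hf] /colourable_inP[g Hg].
have -> : c + d = #|{: 'I_c + 'I_d}| by rewrite card_sum !card_ord.
apply: (@colourable_in_finType _
  (fun x => if x \in A then inl (f x) else inr (g x))) => x y.
rewrite !inE; case: ifP => xA; case: ifP => //= yA; last first.
  by move=> xB yB xy; exact: Hg.
by move=> _ _ xy; exact: Hf.
Qed.

Lemma chi_leq (c : nat) : colourable_in [set: G] c -> chi G <= c.
Proof.
move=> /colourable_inP[f Hf]; rewrite /chi; case: ex_minnP => m _; apply.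
apply/existsP; exists f; apply/forallP=> x; apply/forallP=> y.
by apply/implyP=> xy; apply: Hf; rewrite ?inE.
Qed.

End Colouring.

(** * Long directed paths and long induced paths *)

(** The colour of a vertex is the length of a longest directed path from it; the
bound on lengths already excludes directed cycles. *)
Lemma gallai_roy (T : finType) (e : rel T) (L : nat) :
  (forall x p, path e x p -> size p < L) ->
  exists h : T -> 'I_L, forall x y, e x y -> h y < h x.
Proof.
case: L => [|L] short.
  exists (fun x => Ordinal (short x [::] isT)) => x.
  by have := short x [::] isT.
pose P x (n : 'I_L.+1) := [exists p : n.-tuple T, path e x p].
pose len x := \max_(n < L.+1 | P x n) n.
have len_lt x : len x < L.+1.
  by rewrite ltnS; apply/bigmax_leqP => n _; rewrite -ltnS.
exists (fun x => Ordinal (len_lt x)) => x y xy /=.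
have [|n Pn Dn] := @eq_bigmax_cond _ (P y) (fun n : 'I_L.+1 => n : nat).
  by apply/card_gt0P; exists ord0; apply/existsP; exists [tuple].
rewrite /len Dn; move: Pn => /existsP[p yp].
have xyp : path e x (y :: p) by rewrite /= xy.
have := short _ _ xyp; rewrite /= size_tuple => nL.
apply: (@leq_bigmax_cond _ _ (fun n : 'I_L.+1 => n : nat) (Ordinal nL)).
by apply/existsP; exists [tuple of y :: p].
Qed.

(** Cut the list before each element satisfying [a]: this makes at most [m]
blocks, each starting with its only element satisfying [a], and one of them has
length at least the average. *)
Lemma sparse_block (T : Type) (a : pred T) (m l : nat) (y : T) (p : seq T) :
  a y -> count a (y :: p) <= m -> m * l <= size (y :: p) ->
  exists p1 z r p2, [/\ y :: p = p1 ++ (z :: r) ++ p2, a z, ~~ has a r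
                      & l <= size (z :: r)].
Proof.
elim: m y p => [|m IHm] y p ay; first by rewrite /= ay.
have [pa|pNa] := boolP (has a p); last first.
  move=> _ ml; exists [::], y, p, [::]; split=> //; first by rewrite cats0.
  by apply: leq_trans ml; rewrite mulSn leq_addr.
case: (split_find pa) => z r p2 az rNa.
rewrite /= ay add1n ltnS cat_rcons count_cat => cnt.
rewrite mulSn size_cat -addSn => len.
have [lr|rl] := leqP l (size (y :: r)).
  by exists [::], y, r, (z :: p2).
have [||p1 [z' [r' [p2' [E az' r'Na lr']]]]] := IHm z p2 az.
- exact: leq_trans (leq_addl _ _) cnt.
- by rewrite -(leq_add2l l); apply: leq_trans len _; rewrite leq_add2r ltnW.
by exists (y :: r ++ p1), z', r', p2'; split=> //; rewrite E /= catA.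
Qed.

Section RainbowPaths.
Variables (G : graph) (phi : G -> nat).

(** Rainbow induced paths, as lists; being induced is expressed by letting each
vertex be adjacent to the next one and to no later one. *)
Fixpoint rainbow_path (p : seq G) : bool :=
  if p is x :: q then
    [&& all (fun y => phi x != phi y) q,
        (if q is y :: r then adj x y && ~~ has (adj x) r else true)
      & rainbow_path q]
  else true.

Lemma rainbow_path_take (n : nat) (p : seq G) :
  rainbow_path p -> rainbow_path (take n p).
Proof.
elim: p n => [|x q IHq] [|n] //= /and3P[xq xyr pq].
rewrite IHq // andbT; apply/andP; split.
  by apply/allP => z /mem_take; apply: (allP xq).
case: q xyr {IHq xq pq} => [|y r] //= /andP[xy xr]; case: n => //= n.
rewrite xy; apply: contra xr => /hasP[z /mem_take zr xz].
by apply/hasP; exists z.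
Qed.

(** Number of vertices on a path with forward degrees at most [m] that forces
an induced path on [k] vertices. *)
Fixpoint path_length (m k : nat) : nat :=
  if k is k'.+1 then (m * path_length m k').+1 else 0.

(** The argument of Gyarfas run inside a path.  The neighbours of [x] cut the
rest of the path into at most [m] blocks; the longest one starts with a
neighbour [z] of [x] and contains no other, so it is safe to go to [z] and stay
in this block.  The relation [r] carries whatever is known between earlier and
later vertices, in a form that passes to sublists. *)
Lemma sparse_rainbow_path (r : rel G) (m k : nat) :
  0 < m ->
  (forall x p, pairwise r (x :: p) -> count (adj x) p <= m) ->
  (forall x y, r x y -> phi x != phi y) ->
  forall x p, path (@adj G) x p -> pairwise r (x :: p) ->
  path_length m k.+1 <= (size p).+1 ->
  exists q, rainbow_path (x :: q) /\ size q = k /\ {subset q <= p}.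
Proof.
move=> m_gt0 sparse rphi; elim: k => [|k IHk] x p xp rp len.
  by exists [::].
case: p xp rp len => [|y p].
  by rewrite /= ltnS leqn0 muln_eq0 -leqn0 leqNgt m_gt0.
move=> /andP[xy yp] rp; rewrite [path_length _ _]/= ltnS => len.
have [p1 [z [t [p2 [E xz tNx lt]]]]] :=
  sparse_block xy (sparse _ _ rp) len.
have zt : path (@adj G) z t.
  have : sorted (@adj G) (y :: p) by [].
  by rewrite E => /cat_sorted2[_ /cat_sorted2[]].
have sub : subseq (x :: z :: t) (x :: y :: p).
  rewrite E /= eqxx.
  exact: subseq_trans (prefix_subseq _ _) (suffix_subseq _ _).
have rxzt := subseq_pairwise sub rp.
have rzt : pairwise r (z :: t) by case/andP: rxzt.
have [q [zq [szq qt]]] := IHk z t zt rzt lt.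
exists (z :: q); split; [|split].
- apply/and3P; split=> //; last first.
    rewrite xz /=; apply: contra tNx => /hasP[u /qt ut xu].
    by apply/hasP; exists u.
  move: rxzt => /= /andP[/andP[xz' xt] _]; rewrite (rphi _ _ xz') /=.
  by apply/allP => u /qt ut; apply: rphi; apply: (allP xt).
- by rewrite /= szq.
- move=> u; rewrite inE => uzq; rewrite E !mem_cat inE.
  by case/orP: uzq => [-> | /qt ->]; rewrite ?orbT.
Qed.

End RainbowPaths.

(** * Covers with few colours on outside neighbours *)

Section Cover.
Variables (G : graph) (phi : G -> nat) (s : nat).
Hypothesis phi_proper : Defs.proper phi.
Hypothesis short : forall p : seq G, rainbow_path phi p -> size p < s.

Lemma colourable_cover (m c : nat) (X : G -> {set G}) :
  0 < m ->
  (forall u, colourable_in (X u) c) ->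
  (forall u x, x \in X u -> exists2 T : seq nat, size T <= m &
     forall y v, y \in X v -> y \notin X u -> adj x y -> phi y \in T) ->
  colourable_in (\bigcup_u X u) (c * path_length m s * path_length m s).
Proof.
move=> m_gt0 Xc Xout.
set L := path_length m s; set U := \bigcup_u X u.
pose idx x := find (fun u => x \in X u) (enum G).
pose own x := nth x (enum G) (idx x).
have ownP x : x \in U -> x \in X (own x).
  case/bigcupP=> u _ xu; apply: (@nth_find _ x (fun u => x \in X u)).
  by apply/hasP; exists u; rewrite ?mem_enum.
have ownN x y : idx x < idx y -> y \notin X (own x).
  by move=> xy; rewrite (before_find x xy).
pose before (lt : rel nat) x y :=
  [&& x \in U, y \in U, idx x < idx y & lt (phi x) (phi y)].
have potential (lt : rel nat) : transitive lt -> irreflexive lt ->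
    exists h : G -> 'I_L,
      forall x y, before lt x y && adj x y -> h y < h x.
  move=> lt_trans lt_irr; apply: gallai_roy => x p xp; rewrite ltnNge.
  apply/negP => Lp.
  have before_trans : transitive (before lt).
    move=> y x' z /and4P[xU _ xy lxy] /and4P[_ zU yz lyz].
    by apply/and4P; split=> //; [exact: ltn_trans yz|exact: lt_trans lyz].
  have before_neq y z : before lt y z -> phi y != phi z.
    by case/and4P=> _ _ _; apply: contraTneq => ->; rewrite lt_irr.
  have rp : pairwise (before lt) (x :: p).
    rewrite -sorted_pairwise //; apply: sub_path xp => y z /andP[] //.
  have xp' : path (@adj G) x p by apply: sub_path xp => y z /andP[].
  (* The neighbours of y in q lie outside the first set containing y. *)
  have sparse y q : pairwise (before lt) (y :: q) -> count (adj y) q <= m.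
    rewrite -size_filter /= => /andP[yq rq].
    have [|yNU] := boolP (y \in U); last first.
      by case: q yq {rq} => //= z q; rewrite /before (negPf yNU).
    move=> /ownP/Xout[T sT TP]; apply: leq_trans sT.
    rewrite -(size_map phi); apply: uniq_leq_size.
      rewrite uniq_pairwise pairwise_map.
      apply: sub_pairwise (subseq_pairwise (filter_subseq _ _) rq).
      by move=> z t; apply: before_neq.
    move=> _ /mapP[z + ->]; rewrite mem_filter => /andP[yz zq].
    have /and4P[_ /bigcupP[v _ zv] lyz _] := allP yq z zq.
    by apply: TP zv _ yz; apply: ownN.
  have s_gt0 : 0 < s by apply: (short (p := [::])).
  have [|q [qP [sq _]]] := @sparse_rainbow_path G phi _ m s.-1 m_gt0 sparse
    before_neq x p xp' rp.
    by rewrite prednK //; apply: leq_trans Lp _.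
  by have := short qP; rewrite /= sq prednK // ltnn.
have [h1 h1P] := potential ltn ltn_trans ltnn.
have [|h2 h2P] := potential gtn _ ltnn.
  by move=> a b d ab bd; apply: ltn_trans ab.
pose F u := xchoose (existsP (Xc u)).
have FP u x y : x \in X u -> y \in X u -> adj x y -> F u x != F u y.
  move=> xu yu xy; have /forall_inP/(_ x xu) := xchooseP (existsP (Xc u)).
  by move=> /forall_inP/(_ y yu)/implyP; apply.
have -> : c * L * L = #|{: 'I_c * 'I_L * 'I_L}| by rewrite !card_prod !card_ord.
apply: (@colourable_in_finType _ _ (fun x => (F (own x) x, h1 x, h2 x))).
suff clash x y : x \in U -> y \in U -> adj x y -> idx x <= idx y ->
    (F (own x) x, h1 x, h2 x) != (F (own y) y, h1 y, h2 y).
  move=> x y xU yU xy; case: (leqP (idx x) (idx y)) => [|/ltnW] le_xy.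
    exact: clash.
  by rewrite eq_sym clash // adj_sym.
move=> xU yU xy; rewrite leq_eqVlt => /orP[/eqP Exy|lt_xy]; last first.
  have := phi_proper => /forallP/(_ x)/forallP/(_ y)/implyP/(_ xy).
  rewrite neq_ltn => /orP[] lphi; apply/eqP => -[_ E1 E2].
    suff: h1 y < h1 x by rewrite E1 ltnn.
    by apply: h1P; rewrite /before xU yU lt_xy /= lphi xy.
  suff: h2 y < h2 x by rewrite E2 ltnn.
  by apply: h2P; rewrite /before xU yU lt_xy /= lphi xy.
have own_xy : own x = own y.
  rewrite /own Exy; apply: set_nth_default; rewrite -has_find.
  by have /bigcupP[u _ yu] := yU; apply/hasP; exists u; rewrite ?mem_enum.
have xown : x \in X (own y) by rewrite -own_xy; apply: ownP.
rewrite own_xy.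
by apply: contraNneq (FP (own y) x y xown (ownP y yU) xy) => -[->].
Qed.

(** * Vertices reached by rainbow induced paths *)

Section Reach.
Variable A : {set G}.

(** The bound on the length of [q] makes membership decidable; it loses nothing
as longer paths do not exist. *)
Definition reach (w : seq G) : {set G} :=
  [set x | [exists n : 'I_s, exists q : n.-tuple G,
     all (mem A) (x :: q ++ w) && rainbow_path phi (x :: q ++ w)]].

Lemma reachP (w : seq G) (x : G) :
  reflect (exists2 q, {subset x :: q ++ w <= A}
                    & rainbow_path phi (x :: q ++ w))
          (x \in reach w).
Proof.
rewrite inE; apply: (iffP existsP) => [[n /existsP[q /andP[/allP qA qP]]]|].
  by exists q.
case=> q qA qP; have : size q < s.
  apply: leq_trans (short qP); rewrite /= size_cat ltnS.
  exact: leqW (leq_addr _ _).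
move=> qs; exists (Ordinal qs); apply/existsP; exists (in_tuple q).
by rewrite qP andbT; apply/allP.
Qed.

Lemma reach_nonadj (w : seq G) (u x : G) :
  x \in reach (u :: w) -> ~~ has (adj x) w.
Proof.
case/reachP=> q _ /and3P[_ + _].
case: q => [|y q] /= /andP[_] //.
by rewrite has_cat negb_or => /andP[_] /norP[].
Qed.

(** Start at [y], jump to the last neighbour of [y] on the path, and follow the
path from there. *)
Lemma rainbow_path_attach (w q : seq G) (u y : G) :
  rainbow_path phi (q ++ u :: w) -> phi y \notin map phi (q ++ u :: w) ->
  has (adj y) (rcons q u) -> ~~ has (adj y) w ->
  exists2 r, {subset r <= q} & rainbow_path phi (y :: r ++ u :: w).
Proof.
have neq p : phi y \notin map phi p -> all (fun z => phi y != phi z) p.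
  move=> yNp; apply/allP => z zp; apply: contraNneq yNp => ->.
  exact: map_f.
elim: q => [|a q IHq] qP yNq yq yNw.
  exists [::] => //; apply/and3P; split; [exact: neq| |exact: qP].
  by move: yq; rewrite /= orbF => ->.
have [yq'|yNq'] := boolP (has (adj y) (rcons q u)).
  have qP' : rainbow_path phi (q ++ u :: w) by case/and3P: qP.
  have [|r rq rP] := IHq qP' _ yq' yNw.
    by move: yNq; rewrite inE => /norP[].
  by exists r => // z /rq; rewrite inE orbC => ->.
exists (a :: q) => //; apply/and3P; split; [exact: neq| |exact: qP].
move: yq yNq'; rewrite !has_rcons /= => /or3P[-> | -> | ->]; rewrite ?orbT //.
by move=> /norP[yu yNq']; rewrite has_cat /= negb_or yNq' /= (negPf yu).
Qed.

(** The few colours are those of a single path that reaches [x]: a neighbour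
[y] of [x] avoiding them could be attached to this path.  That [y] is reached
through some [v :: w] ensures that it has no neighbour on [w] itself. *)
Lemma reach_outside (w : seq G) (u x : G) :
  x \in reach (u :: w) -> exists2 T : seq nat, size T <= s &
     forall y v, y \in reach (v :: w) -> y \notin reach (u :: w) ->
       adj x y -> phi y \in T.
Proof.
case/reachP=> q qA qP; exists (map phi (x :: q ++ u :: w)).
  by rewrite size_map ltnW // short.
move=> y v yv yNu xy; apply: contraNT yNu => yNq.
have yA : y \in A by case/reachP: yv => q' /(_ y) + _; apply; rewrite inE eqxx.
have [||r rq rP] := @rainbow_path_attach w (x :: q) u y qP yNq.
- by rewrite /= adj_sym xy.
- exact: reach_nonadj yv.
apply/reachP; exists r => // z; rewrite inE mem_cat.
case/or3P=> [/eqP->//|/rq|] zq; apply: qA; rewrite -cat_cons mem_cat zq //.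
by rewrite orbT.
Qed.

(** Induction on [j], the number of vertices by which [w] may fall short of
[s]. *)
Lemma reach_colourable (t : nat) :
  0 < t ->
  (forall h, h \in A -> colourable_in [set x in A | adj x h] t) ->
  forall j w, s <= size w + j ->
  colourable_in (reach w)
    (iter j (fun c => c * path_length s s * path_length s s + t) 1).
Proof.
move=> t_gt0 Nt; elim=> [|j IHj] w; rewrite ?addn0 => sw.
  apply/colourable_inP; exists [ffun=> ord0] => x y /reachP[q _ /short].
  by rewrite /= size_cat ltnNge (leq_trans sw) // leqW // leq_addl.
have s_gt0 : 0 < s by apply: (short (p := [::])).
have cov : colourable_in (\bigcup_u reach (u :: w))
    (iter j (fun c => c * path_length s s * path_length s s + t) 1
       * path_length s s * path_length s s).
  apply: colourable_cover s_gt0 _ _ => u; first by apply: IHj; rewrite addSnnS.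
  exact: reach_outside.
have rest : colourable_in (reach w :\: \bigcup_u reach (u :: w)) t.
  (* A vertex reached with a vertex u between it and w is reached by u :: w. *)
  have restP x : x \in reach w :\: \bigcup_u reach (u :: w) ->
      {subset x :: w <= A} /\ rainbow_path phi (x :: w).
    rewrite inE => /andP[xN /reachP[q]]; case/lastP: q => [|q u] qA qP //.
    case/negP: xN; apply/bigcupP; exists u => //; apply/reachP.
    by exists q; rewrite -cat_rcons.
  case: w sw cov restP => [|h w] _ _ restP.
    apply: (colourable_inW (subxx _) t_gt0).
    apply/colourable_inP; exists [ffun=> ord0] => x y xR yR xy; exfalso.
    move: (xR); rewrite inE => /andP[/bigcupP[]]; exists y => //.
    have [[xA _] [yA _]] := (restP x xR, restP y yR).
    apply/reachP; exists [::].
      move=> z; rewrite !inE => /orP[] /eqP->.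
        by apply: xA; rewrite inE.
      by apply: yA; rewrite inE.
    have := phi_proper => /forallP/(_ x)/forallP/(_ y)/implyP/(_ xy) => nxy.
    by rewrite /= nxy xy.
  have [->|[x xR]] :=
    set_0Vmem (reach (h :: w) :\: \bigcup_u reach [:: u, h & w]).
    apply: (@colourable_inW _ _ set0 1) => //.
    by apply/colourable_inP; exists [ffun=> ord0] => x y; rewrite inE.
  have hA : h \in A.
    by have [/(_ h) + _] := restP x xR; apply; rewrite !inE eqxx orbT.
  apply: colourable_inW (leqnn _) (Nt h hA); apply/subsetP => y /restP[yA yP].
  rewrite inE yA ?inE ?eqxx //=; by case/and3P: yP => _ /andP[].
apply: colourable_inW (leqnn _) (colourable_inU cov rest).
by apply/subsetP => x xr; rewrite in_setU in_setD xr andbT orbN.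
Qed.

End Reach.

End Cover.

(** * Bounding the chromatic number *)

(** Obtained by [s] steps of [reach_colourable], where the set of neighbours of
a vertex is handled by the bound for the next smaller clique number. *)
Fixpoint clique_bound (s k : nat) : nat :=
  if k is k'.+1 then
    iter s (fun c => c * path_length s s * path_length s s
                     + (clique_bound s k')) 1
  else 1.

Lemma clique_bound_gt0 (s k : nat) : 0 < clique_bound s k.
Proof.
elim: k => //= k IHk; case: s IHk => //= s IHk.
exact: leq_trans IHk (leq_addl _ _).
Qed.

Lemma colourable_of_clique_bound (G : graph) (phi : G -> nat) (s : nat) :
  Defs.proper phi ->
  (forall p : seq G, rainbow_path phi p -> size p < s) ->
  forall k (A : {set G}),
  (forall K : {set G}, K \subset A -> clique K -> #|K| <= k) ->
  colourable_in A (clique_bound s k).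
Proof.
move=> phi_proper short; elim=> [|k IHk] A cliqueA.
  have [->|[x xA]] := set_0Vmem A.
    by apply/colourable_inP; exists [ffun=> ord0] => x y; rewrite inE.
  suff cx : clique [set x].
    by have := cliqueA [set x]; rewrite sub1set cards1 => /(_ xA cx).
  apply/forall_inP => y /set1P->; apply/forall_inP => z /set1P->.
  by rewrite eqxx.
have nbr h : h \in A -> colourable_in [set x in A | adj x h] (clique_bound s k).
  move=> hA; apply: IHk => K /subsetP KN cK.
  have hNK : h \notin K by apply/negP => /KN; rewrite inE adj_irr andbF.
  have := cliqueA (h |: K); rewrite cardsU1 hNK add1n ltnS; apply.
    by apply/subsetP => x /setU1P[->//|/KN]; rewrite inE => /andP[].
  have adjh x : x \in K -> adj x h by move=> /KN; rewrite inE => /andP[].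
  apply/forall_inP => x xK; apply/forall_inP => y yK; apply/implyP => xy.
  case/setU1P: xK xy => [->|xK]; case/setU1P: yK => [->|yK] xy.
  - by rewrite eqxx in xy.
  - by rewrite adj_sym adjh.
  - exact: adjh.
  - by move/forall_inP/(_ x xK)/forall_inP/(_ y yK)/implyP: cK; apply.
have colR : colourable_in (reach phi s A [::]) (clique_bound s k.+1).
  by apply: (reach_colourable phi_proper short (clique_bound_gt0 s k) nbr).
have reachA : A \subset reach phi s A [::].
  apply/subsetP => x xA; apply/(reachP short); exists [::] => //.
  by move=> y; rewrite inE => /eqP->.
exact: colourable_inW reachA (leqnn _) colR.
Qed.

(** * From lists to induced subgraphs *)

Lemma rainbow_path_uniq (G : graph) (phi : G -> nat) (p : seq G) :
  rainbow_path phi p -> uniq p /\ {in p &, injective phi}.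
Proof.
elim: p => [|x q IHq] /=; first by split.
case/and3P=> xq _ /IHq[uq injq].
have xNq y : y \in q -> phi x <> phi y.
  by move=> yq; apply/eqP; apply: (allP xq).
split; first by rewrite uq andbT; apply/negP => /xNq; apply.
move=> y z; rewrite !inE => /predU1P[->|yq] /predU1P[->|zq] // E.
- by case: (xNq z zq).
- by case: (xNq y yq).
exact: injq.
Qed.

Lemma rainbow_path_adj (G : graph) (phi : G -> nat) (x0 : G) (p : seq G) i j :
  rainbow_path phi p -> i < j < size p ->
  adj (nth x0 p i) (nth x0 p j) = (i.+1 == j).
Proof.
elim: p i j => [|x q IHq] i j; first by rewrite ltn0 andbF.
case/and3P=> _ xq qP; case: i j => [|i] [|j] //=; rewrite !ltnS;
  last exact: IHq.
case: q xq {IHq qP} => [|y r] //= /andP[xy xr]; case: j => [|j] //= jr.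
apply: negbTE; apply: contra xr => xj.
by apply/hasP; exists (nth x0 r j); rewrite ?mem_nth.
Qed.

Lemma rainbow_path_induced (G : coloured_graph) (p : seq G) :
  rainbow_path (@colour G) p ->
  rainbow [set x in p] /\
  isomorphic (induced [set x in p]) (path_graph (size p)).
Proof.
move=> pP; have [up injp] := rainbow_path_uniq pP; split.
  by move=> u v; rewrite !inE => pu pv uv E; apply: uv; apply: injp.
have memp (u : induced [set x in p]) : val u \in p.
  by have := valP u; rewrite inE.
have lt_index (u : induced [set x in p]) : index (val u) p < size p.
  by rewrite index_mem.
exists (fun u => Ordinal (lt_index u)); split.
  apply: inj_card_bij => [u v [E]|].
    have Euv : sval u = sval v.
      by rewrite -(nth_index (sval u) (memp u)) E nth_index // memp.
    exact: (val_inj Euv).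
  by rewrite card_ord card_sig cardsE (card_uniqP up).
suff adj_lt (u v : induced [set x in p]) : index (val u) p < index (val v) p ->
    @adj G (val u) (val v) = ((index (val u) p).+1 == index (val v) p).
  move=> u v; rewrite /= /path_adj /induced_adj /=.
  have [lt_uv|lt_vu|Euv] := ltngtP (index (val u) p) (index (val v) p).
  - by rewrite adj_lt // [_.+1 == index (val u) p]gtn_eqF ?orbF // leqW.
  - by rewrite adj_sym adj_lt // [_.+1 == index (val v) p]gtn_eqF // leqW.
  - have -> : val u = val v.
      by rewrite -(nth_index (val u) (memp u)) Euv nth_index.
    by rewrite adj_irr orbb eqn_leq ltnn.
move=> lt_uv; rewrite -{1}(nth_index (val u) (memp u)).
rewrite -{1}(nth_index (val u) (memp v)).
by rewrite (rainbow_path_adj _ pP) // lt_uv lt_index.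
Qed.

Theorem mainTheorem1 (kappa s : nat) (hkappa : 1 <= kappa) (hs : 1 <= s) :
  exists c : nat,
    forall G : coloured_graph,
      omega G <= kappa -> c < chi G ->
      exists A : {set G}, rainbow A /\ isomorphic (induced A) (path_graph s).
Proof.
exists (clique_bound s kappa) => G omegaG chiG.
have [_ phi_proper] := colourP G.
have [|noP] := boolP [exists p : s.-tuple G, rainbow_path (@colour G) p].
  case/existsP=> p pP; exists [set x in p].
  by have := rainbow_path_induced pP; rewrite size_tuple.
suff : colourable_in [set: G] (clique_bound s kappa).
  by move/chi_leq; rewrite leqNgt chiG.
apply: (colourable_of_clique_bound phi_proper) => [p pP|K _ cK].
  rewrite ltnNge; apply: contra noP => sp; apply/existsP.
  have /eqP sz : size (take s p) = s by rewrite size_takel.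
  by exists (Tuple sz); apply: rainbow_path_take.
apply: leq_trans omegaG.
exact: (@leq_bigmax_cond _ (@clique G) (fun A : {set G} => #|A|) K).
Qed.
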